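(* Let $\gamma\in\mathcal P(\mathcal U\times\mathcal Y)$ be the joint law of $(u,y)$, with marginal law $\kappa$ on $\mathcal Y$ and conditional law $\pi(\cdot\mid y)$ on $\mathcal U$. For each $\theta\in\Theta$ let $B_\theta(\cdot\,;y)$, $y\in\mathcal Y$, be a family of probability measures on $\mathcal U$. Then, for every $\theta\in\Theta$, $$\mathbb E^{y\sim\kappa}\Big[\mathsf D_E^2\big(\pi(\cdot\mid y),B_\theta(\cdot\,;y)\big)\Big]=2\,\mathbb E^{(u,y)\sim\gamma}\Big[\mathsf{ES}\big(B_\theta(\cdot\,;y),u\big)\Big]-\mathsf{const},$$ where $$\mathsf{const}:=\mathbb E^{y\sim\kappa}\Big[\mathbb E^{(u,u')\sim\pi(\cdot\mid y)\otimes\pi(\cdot\mid y)}\|u-u'\|\Big]$$ is independent of $\theta$. Consequently, minimizing the expected energy score $\theta\mapsto\mathbb E^{(u,y)\sim\gamma}[\mathsf{ES}(B_\theta(\cdot\,;y),u)]$ over $\Theta$ is equivalent to minimizing $\theta\mapsto\mathbb E^{y\sim\kappa}[\mathsf D_E^2(\pi(\cdot\mid y),B_\theta(\cdot\,;y))]$ over $\Theta$ (the two objectives have the same minimizers).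
   Context: $\mathcal U$ is a separable Banach space with norm $\|\cdot\|$ (the parameter space) and $\mathcal Y$ is the observation space (a standard Borel measurable space); $\mathcal P(\cdot)$ denotes the set of Borel probability measures; $\Theta$ is the parameter set. The conditional law $\pi(\cdot\mid y)$ is a regular conditional distribution, so $\gamma(du,dy)=\pi(du\mid y)\,\kappa(dy)$. For each $\theta$, $y\mapsto B_\theta(\cdot\,;y)$ is a Markov kernel from $\mathcal Y$ to $\mathcal U$. For probability measures $\mu,\nu$ on $\mathcal U$ the (squared) energy distance is $$\mathsf D_E^2(\mu,\nu):=2\,\mathbb E^{(u,v)\sim\mu\otimes\nu}\|u-v\|-\mathbb E^{(u,u')\sim\mu\otimes\mu}\|u-u'\|-\mathbb E^{(v,v')\sim\nu\otimes\nu}\|v-v'\|,$$ and for a probability measure $\nu$ on $\mathcal U$ and $u\in\mathcal U$ the energy score is $$\mathsf{ES}(\nu,u):=\mathbb E^{v\sim\nu}\|u-v\|-\tfrac12\,\mathbb E^{(v,v')\sim\nu\otimes\nu}\|v-v'\|.$$ Here $\mathbb E^{x\sim\mu}$ denotes expectation when $x$ has law $\mu$. Convention: all expectations involved are finite; that is, for every $\theta\in\Theta$, the $\kappa$-averages over $y$ of each of the three expectations in the definition of $\mathsf D_E^2(\pi(\cdot\mid y),B_\theta(\cdot\,;y))$ are finite. *)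

(* Defs.v *)
From HB Require Import structures.
From mathcomp Require Import all_boot all_order all_algebra.
From mathcomp Require Import all_classical all_reals all_analysis.

Set Implicit Arguments.
Unset Strict Implicit.
Unset Printing Implicit Defensive.

Import Order.TTheory GRing.Theory Num.Theory.
Import numFieldNormedType.Exports.

Local Open Scope classical_set_scope.
Local Open Scope ring_scope.

Definition separable_space (T : topologicalType) : Prop :=
  exists2 D : set T, countable D & dense D.

(* The type [U] itself, equipped with its Borel sigma-algebra. *)
Notation borelType U := (g_sigma_algebraType (@open U)).

(* [Y] carries the Borel sigma-algebra of a Polish space, transported along a
   bijection; Hausdorff makes the pseudometric of [P] a metric. *)
Definition standard_borel (R : realType) d (Y : measurableType d) : Prop :=
  exists (P : completePseudoMetricType R) (f : Y -> P),
    [/\ hausdorff_space P, separable_space P, bijective f &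
        (@measurable d Y) = [set f @^-1` B | B in <<s @open P >>]].

(* The value at [x] of a Markov kernel, packed as a probability measure. *)
Section kernel_at.
Context d d' (X : measurableType d) (Y : measurableType d') (R : realType).
Variables (k : R.-pker X ~> Y) (x : X).

Definition kernel_at : set Y -> \bar R := k x.

HB.instance Definition _ := Measure.on kernel_at.
HB.instance Definition _ :=
  Measure_isProbability.Build d' Y R kernel_at (@prob_kernel _ _ _ _ _ k x).

End kernel_at.

Section joint_law.
Context d d' (U : measurableType d) (Y : measurableType d') (R : realType).

Definition is_marginal_snd (gamma : probability (U * Y)%type R)
    (kappa : probability Y R) : Prop :=
  forall B : set Y, measurable B -> kappa B = pushforward gamma snd B.

(* [pi] is a regular conditional distribution of the first component given the
   second: gamma(du, dy) = pi(du | y) kappa(dy). *)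
Definition is_conditional_law (gamma : probability (U * Y)%type R)
    (kappa : probability Y R) (pi : R.-pker Y ~> U) : Prop :=
  forall (A : set U) (B : set Y), measurable A -> measurable B ->
    gamma (A `*` B) = (\int[kappa]_(y in B) pi y A)%E.

End joint_law.

Section energy.
Local Open Scope ereal_scope.
Context (R : realType) (U : completeNormedModType R).
Implicit Types mu nu : probability (borelType U) R.

Definition mean_dist mu nu : \bar R :=
  \int[mu \x nu]_z (`|(z.1 : U) - (z.2 : U)|%R)%:E.

(* Extended-real valued; it is the usual real number as soon as the three
   expectations are finite. *)
Definition energy_distance2 mu nu : \bar R :=
  2%:E * mean_dist mu nu - mean_dist mu mu - mean_dist nu nu.

Definition energy_score nu (u : U) : \bar R :=
  \int[nu]_v (`|u - (v : U)|%R)%:E - (2^-1)%:E * mean_dist nu nu.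

End energy.

Definition minimizers (R : realType) (Theta : Type) (f : Theta -> \bar R) :
    set Theta :=
  [set t | forall t', (f t <= f t')%E].

(* Main.v *)
Require Import Defs.
From HB Require Import structures.
From mathcomp Require Import all_boot all_order all_algebra.
From mathcomp Require Import all_classical all_reals all_analysis.
From mathcomp Require Import measurable_realfun lra.

Set Implicit Arguments.
Unset Strict Implicit.
Unset Printing Implicit Defensive.

Import Order.TTheory GRing.Theory Num.Theory.
Import numFieldNormedType.Exports.

Local Open Scope classical_set_scope.
Local Open Scope ring_scope.
Local Open Scope ereal_scope.

(** Write c(y), p(y), b(y) for the mean distances of the pairs
    (pi(.|y), B(.;y)), (pi(.|y), pi(.|y)) and (B(.;y), B(.;y)).  The energy
    distance at y is 2 c(y) - p(y) - b(y).  Disintegrating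
    gamma(du, dy) = pi(du|y) kappa(dy) and applying Tonelli to the first term
    of the energy score turns the expected score into E c - E b / 2, so that
    doubling it and subtracting E p gives back E [2 c - p - b].  All three
    expectations are finite, so the two objectives differ by a strictly
    increasing affine map, and such a map preserves minimizers.

    Two measure-theoretic points carry the argument.
    - [measurable_dist]: in a separable space the distance is measurable for
      the product of the two Borel sigma-algebras, which is what Tonelli and
      the measurability of y |-> c(y), p(y), b(y) require.
    - [integral_disintegration]: the defining property of a conditional law,
      given on rectangles only, extends to integrals of all nonnegative
      measurable functions.

    The functions c, p, b may take the value +oo on a negligible set; they are
    therefore handled as extended-real integrable functions, and no pointwise
    finiteness is claimed. *)

(** * Measurability of the distance *)

Section distance.
Context (R : realType) (U : completeNormedModType R).

Lemma measurable_dist_point (a : U) :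
  measurable_fun [set: borelType U] (fun u : borelType U => `|(u : U) - a|%R).
Proof.
apply: (measurability _ (RGenInftyO.measurableE R)) => _ [_ [r ->] <-].
rewrite setTI; apply: sub_sigma_algebra => /=.
apply: (@open_comp U R (fun u : U => `|u - a|%R)); last exact: interval_open.
move=> u _; apply: cvg_norm.
by apply: cvgB; [exact: cvg_id|exact: cvg_cst].
Qed.

(** The distance is continuous, hence Borel on the product space, but the Borel
    sigma-algebra of the product may exceed the product of the Borel
    sigma-algebras.  For D countable and dense, |u - v| < r holds iff
    |u - a| + |v - a| < r for some a in D, which writes the sublevel set as a
    countable union of sets of the product sigma-algebra. *)
Lemma measurable_dist (U_separable : separable_space U) :
  measurable_fun [set: borelType U * borelType U]
    (fun z => `|(z.1 : U) - (z.2 : U)|%R).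
Proof.
have [D cD dD] := U_separable.
apply: (measurability _ (RGenInftyO.measurableE R)) => _ [_ [r ->] <-].
rewrite setTI.
rewrite (_ : _ @^-1` _ = \bigcup_(a in D) [set z : borelType U * borelType U |
    (`|(z.1 : U) - a| + `|(z.2 : U) - a| < r)%R]).
  rewrite bigcup_set_type; apply: countable_bigcupT_measurable.
    by rewrite (eq_countable (card_setT _)).
  move=> [a _] /=.
  rewrite -[X in measurable X]setTI.
  rewrite (_ : [set z | _] = (fun z : borelType U * borelType U =>
    (`|(z.1 : U) - a| + `|(z.2 : U) - a|)%R) @^-1` `]-oo, r[%classic).
    apply: measurable_funD => //.
      exact: measurableT_comp (measurable_dist_point a) measurable_fst.
    exact: measurableT_comp (measurable_dist_point a) measurable_snd.
  by apply/seteqP; split => z /=; rewrite in_itv.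
apply/seteqP; split => [[u v]/=|[u v] [a Da]/=]; rewrite in_itv/=; last first.
  by apply: le_lt_trans; rewrite (distrC v a) ler_distD.
move=> uvr.
(* if a is within half of the slack r - |u - v| of u, the detour from u to v
   through a is still shorter than r *)
have e0 : (0 < (r - `|u - v|) / 2)%R by rewrite divr_gt0// subr_gt0.
have [a [uar Da]] :
    (ball (u : U) ((r - `|(u : U) - (v : U)|) / 2)%R `&` D) !=set0.
  apply: dD; last exact: ball_open.
  by exists u; exact: ballxx.
exists a => //=; move: uar; rewrite -ball_normE/= => uar.
have := ler_distD u v a; rewrite (distrC v u).
lra.
Qed.

End distance.

(** * Kernels and disintegration *)

Section pullback.
Context d d' d'' (X : measurableType d) (Y : measurableType d')
  (Z : measurableType d'') (R : realType).
Variables (k : R.-pker Y ~> Z) (f : X -> Y).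

(** With f a projection, this makes a kernel depend on further parameters along
    which it is constant, so that the measurability of parametrized integrals
    applies to integrands of these parameters. *)
Definition kpullback (mf : measurable_fun setT f) (x : X) :
  {measure set Z -> \bar R} := k (f x).

Hypothesis mf : measurable_fun setT f.

Let measurable_kpullback A : measurable A ->
  measurable_fun [set: X] (kpullback mf ^~ A).
Proof. by move=> mA; exact: measurableT_comp (measurable_kernel k _ mA) mf. Qed.

HB.instance Definition _ := isKernel.Build _ _ _ _ _ (kpullback mf)
  measurable_kpullback.

Let kpullback_setT x : kpullback mf x setT = 1.
Proof. exact: prob_kernel. Qed.

HB.instance Definition _ := Kernel_isProbability.Build _ _ _ _ _
  (kpullback mf) kpullback_setT.

End pullback.

Section graph.
Context d d' (U : measurableType d) (Y : measurableType d') (R : realType).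
Variable k : R.-pker Y ~> U.

(** The law of (u, y) for u distributed as k(.|y), with y fixed.  Mixing these
    laws over a law kappa of y gives k(du|y) kappa(dy) as a composition of
    kernels. *)
Definition kgraph (y : Y) : {measure set (U * Y) -> \bar R} :=
  kernel_at k y \x dirac y.

Let measurable_kgraph A : measurable A ->
  measurable_fun [set: Y] (kgraph ^~ A).
Proof.
move=> mA.
apply: (measurable_fun_integral_finite_kernel
    (fun z : Y * U => \d_z.1 (xsection A z.2)) k) => //.
rewrite (_ : (fun _ => _) = (fun z => (\1_A (z.2, z.1))%:E)).
  apply/measurable_EFinP; apply: measurableT_comp => //.
  by apply: measurable_fun_pair.
by apply/funext => -[y u]; rewrite diracE /= indicE mem_xsection.
Qed.

HB.instance Definition _ := isKernel.Build _ _ _ _ _ kgraph measurable_kgraph.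

Let kgraph_setT y : kgraph y setT = 1.
Proof. exact: probability_setT. Qed.

HB.instance Definition _ := Kernel_isProbability.Build _ _ _ _ _
  kgraph kgraph_setT.

Lemma kgraphX y (A : set U) (B : set Y) : measurable A -> measurable B ->
  kgraph y (A `*` B) = k y A * \d_y B.
Proof. exact: product_measure1E. Qed.

Lemma integral_kgraph y (f : U * Y -> \bar R) :
  (forall z, 0 <= f z) -> measurable_fun setT f ->
  \int[kgraph y]_z f z = \int[k y]_u f (u, y).
Proof.
move=> f0 mf; rewrite /kgraph (fubini_tonelli1 f)//.
apply: eq_integral => u _ /=; rewrite /fubini_F integral_dirac ?diracT ?mul1e//.
exact: measurableT_comp.
Qed.

End graph.

Section disintegration.
Context d d' (U : measurableType d) (Y : measurableType d') (R : realType).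
Variables (gamma : probability (U * Y)%type R) (kappa : probability Y R)
  (pi : R.-pker Y ~> U).
Hypothesis gamma_pi : is_conditional_law gamma kappa pi.

(* [kcomp] composes kernels over a space of parameters, taken here to be a
   single point. *)
Let kappa_ker : R.-pker unit ~> Y :=
  kprobability (measurable_cst (kappa : pprobability Y R)).
Let graph_ker : R.-pker (unit * Y)%type ~> (U * Y)%type :=
  kpullback (kgraph pi) measurable_snd.

(** Rectangles form a pi-system generating the product sigma-algebra, so that
    gamma is the composition of kappa with the graph kernel of pi. *)
Lemma integral_disintegration (f : U * Y -> \bar R) :
  (forall z, 0 <= f z) -> measurable_fun setT f ->
  \int[gamma]_z f z = \int[kappa]_y \int[pi y]_u f (u, y).
Proof.
move=> f0 mf.
transitivity (\int[kcomp kappa_ker graph_ker tt]_z f z).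
  apply: eq_measure_integral => A mA _.
  apply: (measure_unique [set A `*` B | A in measurable & B in measurable]
    (fun=> setT)) => //.
  - exact: measurable_prod_measurableType.
  - move=> _ _ [A1 mA1 [B1 mB1 <-]] [A2 mA2 [B2 mB2 <-]].
    rewrite -setXI; exists (A1 `&` A2); first exact: measurableI.
    by exists (B1 `&` B2); first exact: measurableI.
  - by move=> _; exists setT => //; exists setT => //; rewrite setXTT.
  - by rewrite bigcup_const.
  - move=> _ [A1 mA1 [B1 mB1 <-]]; apply: (etrans (gamma_pi mA1 mB1)).
    rewrite [LHS]integral_mkcond/= /kcomp; apply: eq_integral => y _.
    rewrite [RHS](kgraphX pi y mA1 mB1) diracE patchE.
    by case: ifPn; rewrite ?mule1 ?mule0.
  - by move=> _; rewrite [X in X < _](probability_setT gamma) ltry.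
rewrite integral_kcomp//; apply: eq_integral => y _.
by rewrite integral_kgraph.
Qed.

Lemma integral_conditional_snd (g : Y -> \bar R) :
  (forall y, 0 <= g y) -> measurable_fun setT g ->
  \int[gamma]_z g z.2 = \int[kappa]_y g y.
Proof.
move=> g0 mg.
have mg2 : measurable_fun [set: U * Y] (fun z => g z.2).
  exact: measurableT_comp mg measurable_snd.
rewrite (integral_disintegration (fun z => g0 z.2) mg2).
apply: eq_integral => y _ /=.
by rewrite (integral_cst (pi y) measurableT (g y)) prob_kernel mule1.
Qed.

End disintegration.

(** * Energy distance and energy score *)

(** Multiplication by 2 distributes over x - b / 2 because x and b are finite;
    this is the step that can fail in the extended reals. *)
Lemma energy_balance (R : realType) (x p b : \bar R) :
  x \is a fin_num -> b \is a fin_num ->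
  2%:E * x - p - b = 2%:E * (x - (2^-1)%:E * b) - p.
Proof.
move=> xfin bfin.
rewrite muleBr ?fin_num_adde_defl ?fin_numN ?fin_numM// muleA -EFinM.
by rewrite mulfV// mul1e addeAC.
Qed.

Section energy.
Context (R : realType) (U : completeNormedModType R).
Hypothesis U_separable : separable_space U.

Let dist (u v : borelType U) : \bar R := (`|(u : U) - (v : U)|%R)%:E.

Let dist_ge0 u v : 0 <= dist u v.
Proof. by rewrite lee_fin. Qed.

Let measurable_dist_comp d (X : measurableType d) (f g : X -> borelType U) :
  measurable_fun setT f -> measurable_fun setT g ->
  measurable_fun setT (fun x => dist (f x) (g x)).
Proof.
move=> mf mg; apply/measurable_EFinP.
exact: measurableT_comp (measurable_dist U_separable)
  (measurable_fun_pair mf mg).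
Qed.

Lemma mean_dist_ge0 (mu nu : probability (borelType U) R) :
  0 <= mean_dist mu nu.
Proof. by apply: integral_ge0 => z _; rewrite lee_fin. Qed.

Lemma mean_distE (mu nu : probability (borelType U) R) :
  mean_dist mu nu = \int[mu]_u \int[nu]_v dist u v.
Proof.
rewrite /mean_dist (fubini_tonelli1 (fun z => dist z.1 z.2))//.
exact: measurable_dist_comp.
Qed.

Context d (Y : measurableType d).
Implicit Types k l : R.-pker Y ~> borelType U.

Lemma measurable_integral_dist l : measurable_fun setT
  (fun z : borelType U * Y => \int[l z.2]_v dist z.1 v).
Proof.
apply: (measurable_fun_integral_finite_kernel
  (fun z : (borelType U * Y) * borelType U => dist z.1.1 z.2)
  (kpullback l (@measurable_snd _ _ (borelType U) Y))) => //.
apply: measurable_dist_comp => //.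
exact: measurableT_comp measurable_fst measurable_fst.
Qed.

Lemma measurable_mean_dist k l :
  measurable_fun setT (fun y => mean_dist (kernel_at k y) (kernel_at l y)).
Proof.
under eq_fun do rewrite mean_distE.
apply: (measurable_fun_integral_finite_kernel
  (fun z : Y * borelType U => \int[l z.1]_v dist z.2 v) k) => //.
  by move=> z; exact: integral_ge0.
have swapped := measurableT_comp (measurable_integral_dist l)
  (@measurable_swap _ _ Y (borelType U)).
exact: swapped.
Qed.

Lemma integrable_mean_dist (kappa : probability Y R) k l :
  \int[kappa]_y mean_dist (kernel_at k y) (kernel_at l y) < +oo ->
  kappa.-integrable setT (fun y => mean_dist (kernel_at k y) (kernel_at l y)).
Proof.
move=> fin; apply/integrableP; split; first exact: measurable_mean_dist.
by under eq_integral do rewrite gee0_abs ?mean_dist_ge0//.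
Qed.

Context (kappa : probability Y R) (pi B : R.-pker Y ~> borelType U).
Let cross y := mean_dist (kernel_at pi y) (kernel_at B y).
Let diag_pi y := mean_dist (kernel_at pi y) (kernel_at pi y).
Let diag_B y := mean_dist (kernel_at B y) (kernel_at B y).
Hypotheses (cross_finite : \int[kappa]_y cross y < +oo)
  (pi_finite : \int[kappa]_y diag_pi y < +oo)
  (B_finite : \int[kappa]_y diag_B y < +oo).

Lemma expected_energy_distance2 :
  \int[kappa]_y energy_distance2 (kernel_at pi y) (kernel_at B y) =
  2%:E * \int[kappa]_y cross y - \int[kappa]_y diag_pi y
    - \int[kappa]_y diag_B y.
Proof.
have ic := integrable_mean_dist cross_finite.
have ip := integrable_mean_dist pi_finite.
have iB := integrable_mean_dist B_finite.
rewrite -integralZl// -integralB//; last exact: integrableZl.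
by rewrite -integralB//; apply: integrableB => //; exact: integrableZl.
Qed.

Context (gamma : probability (borelType U * Y)%type R).
Hypothesis gamma_pi : is_conditional_law gamma kappa pi.

Lemma expected_energy_score :
  \int[gamma]_uy energy_score (kernel_at B uy.2) uy.1 =
  \int[kappa]_y cross y - (2^-1)%:E * \int[kappa]_y diag_B y.
Proof.
have mB : measurable_fun [set: borelType U * Y] (fun uy => diag_B uy.2).
  exact: measurableT_comp (measurable_mean_dist B B) measurable_snd.
have int_dist : \int[gamma]_uy \int[B uy.2]_v dist uy.1 v =
    \int[kappa]_y cross y.
  rewrite (integral_disintegration gamma_pi)//.
  - by apply: eq_integral => y _; rewrite /cross mean_distE.
  - by move=> z; exact: integral_ge0.
  - exact: measurable_integral_dist.
have int_diag : \int[gamma]_uy diag_B uy.2 = \int[kappa]_y diag_B y.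
  exact: (integral_conditional_snd gamma_pi
    (fun y => mean_dist_ge0 _ _) (measurable_mean_dist B B)).
have i_dist : gamma.-integrable setT (fun uy => \int[B uy.2]_v dist uy.1 v).
  apply/integrableP; split; first exact: measurable_integral_dist.
  under eq_integral do rewrite gee0_abs ?integral_ge0//.
  by rewrite int_dist.
have i_diag : gamma.-integrable setT (fun uy => diag_B uy.2).
  apply/integrableP; split => //.
  under eq_integral do rewrite gee0_abs ?mean_dist_ge0//.
  by rewrite int_diag.
rewrite -int_dist -int_diag -integralZl// -integralB//.
exact: integrableZl.
Qed.

Lemma expected_energy_distance2_score :
  \int[kappa]_y energy_distance2 (kernel_at pi y) (kernel_at B y) =
  2%:E * \int[gamma]_uy energy_score (kernel_at B uy.2) uy.1 -
  \int[kappa]_y diag_pi y.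
Proof.
rewrite expected_energy_distance2 expected_energy_score.
apply: energy_balance; last first.
  exact: integrable_fin_num (integrable_mean_dist B_finite).
exact: integrable_fin_num (integrable_mean_dist cross_finite).
Qed.

End energy.

(** * Minimizers *)

(** The finiteness of the constant is asked only when there is a point at which
    to evaluate the objectives; on an empty domain both sets of minimizers are
    empty. *)
Lemma minimizers_affine (R : realType) (Theta : Type) (f g : Theta -> \bar R)
    (a c : \bar R) :
  0 < a -> a \is a fin_num -> (Theta -> c \is a fin_num) ->
  (forall t, g t = a * f t - c) -> minimizers f = minimizers g.
Proof.
move=> a0 afin cfin gE.
have le_fg t t' : (g t <= g t') = (f t <= f t').
  by rewrite !gE leeD2rE ?fin_numN ?cfin// lee_pmul2l.
by apply/seteqP; split => t tmin t'; have := tmin t'; rewrite /= le_fg.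
Qed.

Theorem lemma2p3 (R : realType) (U : completeNormedModType R)
    (U_separable : separable_space U)
    (d : measure_display) (Y : measurableType d)
    (Y_standard : standard_borel R Y)
    (gamma : probability (borelType U * Y)%type R)
    (kappa : probability Y R) (pi : R.-pker Y ~> borelType U)
    (gamma_kappa : is_marginal_snd gamma kappa)
    (gamma_pi : is_conditional_law gamma kappa pi)
    (Theta : Type) (B : Theta -> R.-pker Y ~> borelType U)
    (cross_finite : forall theta,
      \int[kappa]_y mean_dist (kernel_at pi y) (kernel_at (B theta) y) < +oo)
    (pi_finite : forall theta : Theta,
      \int[kappa]_y mean_dist (kernel_at pi y) (kernel_at pi y) < +oo)
    (B_finite : forall theta,
      \int[kappa]_y mean_dist (kernel_at (B theta) y) (kernel_at (B theta) y)
        < +oo) :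
  let const := \int[kappa]_y mean_dist (kernel_at pi y) (kernel_at pi y) in
  let expected_distance := fun theta =>
    \int[kappa]_y energy_distance2 (kernel_at pi y) (kernel_at (B theta) y) in
  let expected_score := fun theta =>
    \int[gamma]_uy energy_score (kernel_at (B theta) uy.2) uy.1 in
  (forall theta,
     expected_distance theta = 2%:E * expected_score theta - const) /\
  minimizers expected_score = minimizers expected_distance.
Proof.
move=> const expected_distance expected_score.
have distE theta : expected_distance theta =
    2%:E * expected_score theta - const.
  exact: (expected_energy_distance2_score U_separable (cross_finite theta)
    (pi_finite theta) (B_finite theta) gamma_pi).
split=> //.
apply: (minimizers_affine (a := 2%:E) (c := const)) => //.
move=> theta; apply: integrable_fin_num => //.
exact: integrable_mean_dist (pi_finite theta).
Qed.
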